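(* Let $\rho:\mathfrak g\to\mathfrak{gl}(V)$ be a representation of a finite-dimensional complex Lie algebra $\mathfrak g$ on a finite-dimensional complex vector space $V$. Assume that $f_1,\dots,f_m\in\mathbb C[V]$ are algebraically independent invariant polynomials of $\rho$ with $\deg f_1\le\dots\le\deg f_m$. Let $\mathsf v_1(\rho)\le\dots\le\mathsf v_q(\rho)$ be the vertical indices of $\rho$. Then $\deg f_i\ge\mathsf v_i(\rho)$ for $i=1,\dots,m$.
   Context: All objects are over $\mathbb C$. Jordan–Kronecker form: for linear maps $A,B:U\to W$ of finite-dimensional spaces there are bases of $U$ and $W$ in which every $A+\lambda B$ is block-diagonal with blocks $A_i+\lambda B_i$ of the following types, the number and types of blocks being unique up to permutation: (1) Jordan block with eigenvalue $\lambda_0\in\mathbb C$: $A_i$ is a square upper triangular Jordan block with eigenvalue $\lambda_0$ and $B_i=-I$; (2) Jordan block with eigenvalue $\infty$: $A_i=I$ and $B_i=-N$, where $N$ is the nilpotent Jordan block; (3) horizontal Kronecker block of size $(h-1)\times h$, $h\ge 1$: $A_i=(0\mid I_{h-1})$, $B_i=-(I_{h-1}\mid 0)$; (4) vertical Kronecker block of size $v\times(v-1)$, $v\ge1$: $A_i=\binom{0}{I_{v-1}}$, $B_i=-\binom{I_{v-1}}{0}$. A zero $m\times n$ block is regarded as $m$ vertical blocks of size $1\times0$ and $n$ horizontal blocks of size $0\times1$. The vertical indices of the pencil are the heights $v$ of its vertical Kronecker blocks; its horizontal indices are the widths $h$ of its horizontal Kronecker blocks. For $x\in V$ let $R_x:\mathfrak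 g\to V$, $R_x(\xi)=\rho(\xi)x$. There is a non-empty Zariski open set of pairs $(a,b)\in V\times V$ for which the number of distinct eigenvalues in $\mathbb C\cup\{\infty\}$, the number and sizes of Jordan blocks for each eigenvalue, and the horizontal and vertical indices of the pencil $R_a+\lambda R_b$ are one and the same; such pairs are called generic. The vertical indices of $\rho$ are those of $R_a+\lambda R_b$ for generic $(a,b)$. An invariant polynomial is $f\in\mathbb C[V]$ with $df(x)(\rho(\xi)x)=0$ for all $x\in V$, $\xi\in\mathfrak g$. *)

(* Defs.v *)
From HB Require Import structures.
From mathcomp Require Import all_boot all_order all_algebra.
From mathcomp Require Export complex reals.
From mathcomp Require Export mpoly.

Set Implicit Arguments.
Unset Strict Implicit.
Unset Printing Implicit Defensive.

Import GRing.Theory.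
Local Open Scope ring_scope.

Record is_lie_bracket (K : fieldType) (g : vectType K) (br : g -> g -> g) :
    Prop := IsLieBracket {
  lie_linearl : forall z : g, linear (br^~ z);
  lie_linearr : forall z : g, linear (br z);
  lie_alt : forall x : g, br x x = 0;
  lie_jacobi : forall x y z : g,
    br x (br y z) + br y (br z x) + br z (br x y) = 0 }.

Definition is_lie_rep (K : fieldType) (g : vectType K) (br : g -> g -> g)
    (V : vectType K) (rho : 'Hom(g, 'End(V))) : Prop :=
  forall x y : g,
    rho (br x y) = (rho x \o rho y)%VF - (rho y \o rho x)%VF.

Definition orbit_map (K : fieldType) (g V : vectType K)
    (rho : 'Hom(g, 'End(V))) (x : V) : 'Hom(g, V) :=
  linfun (fun xi : g => rho xi x).

(* linfun f is only meaningful for linear f. *)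
Lemma orbit_mapE (K : fieldType) (g V : vectType K)
    (rho : 'Hom(g, 'End(V))) (x : V) (xi : g) :
  orbit_map rho x xi = rho xi x.
Proof.
have lin : linear (fun xi : g => rho xi x).
  by move=> c u v; rewrite linearP add_lfunE scale_lfunE.
pose m := GRing.isLinear.Build K g V _ (fun xi : g => rho xi x) lin.
pose f : {linear g -> V} := HB.pack (fun xi : g => rho xi x) m.
by rewrite /orbit_map -[RHS](lfunE f).
Qed.

(* C[V]: polynomials in the coordinates with respect to the basis
   vbasis {:V}.  Degree, algebraic independence, evaluation, differentials
   and the Zariski topology do not depend on the choice of the basis. *)

Definition coords (K : fieldType) (V : vectType K) (x : V)
    (i : 'I_(\dim {: V})) : K :=
  coord (vbasis {: V}) i x.

Definition pf_eval (K : fieldType) (V : vectType K)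
    (f : {mpoly K[\dim {: V}]}) (x : V) : K := f.@[coords x].

(* df(x)(y) *)
Definition pf_diff (K : fieldType) (V : vectType K)
    (f : {mpoly K[\dim {: V}]}) (x y : V) : K :=
  \sum_(i < \dim {: V}) pf_eval f^`M(i) x * coords y i.

(* Total degree; msize is the degree plus 1 on nonzero polynomials. *)
Definition pf_deg (K : fieldType) (n : nat) (f : {mpoly K[n]}) : nat :=
  (msize f).-1.

Definition alg_independent (K : fieldType) (n m : nat)
    (f : m.-tuple {mpoly K[n]}) : Prop :=
  forall p : {mpoly K[m]}, p \mPo f = 0 -> p = 0.

Definition zariski_open (K : fieldType) (V : vectType K) (U : V -> Prop) :
    Prop :=
  exists S : {mpoly K[\dim {: V}]} -> Prop,
    forall x : V, U x <-> exists2 p, S p & pf_eval p x != 0.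

Definition invariant_poly (K : fieldType) (g V : vectType K)
    (rho : 'Hom(g, 'End(V))) (f : {mpoly K[\dim {: V}]}) : Prop :=
  forall (x : V) (xi : g), pf_diff f x (rho xi x) = 0.

(* Jordan-Kronecker blocks.  The eigenvalue None stands for infinity.
   Jordan mu n is n x n, Horizontal h is (h - 1) x h, and Vertical v is
   v x (v - 1). *)

Inductive jk_block (K : Type) : Type :=
  | Jordan (mu : option K) (n : nat)
  | Horizontal (h : nat)
  | Vertical (v : nat).
Arguments Horizontal {K} h.
Arguments Vertical {K} v.

Definition jkb_pos (K : Type) (b : jk_block K) : bool :=
  match b with Jordan _ n => 0 < n | Horizontal h => 0 < h
             | Vertical v => 0 < v end%N.

Definition jkb_rows (K : Type) (b : jk_block K) : nat :=
  match b with Jordan _ n => n | Horizontal h => h.-1 | Vertical v => v end.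

Definition jkb_cols (K : Type) (b : jk_block K) : nat :=
  match b with Jordan _ n => n | Horizontal h => h | Vertical v => v.-1 end.

Definition diag_one (K : fieldType) (m n : nat) : 'M[K]_(m, n) :=
  \matrix_(i, j) (i == j :> nat)%:R.
Definition superdiag_one (K : fieldType) (m n : nat) : 'M[K]_(m, n) :=
  \matrix_(i, j) (i.+1 == j)%:R.
Definition subdiag_one (K : fieldType) (m n : nat) : 'M[K]_(m, n) :=
  \matrix_(i, j) (i == j.+1 :> nat)%:R.

Definition jkb_A (K : fieldType) (b : jk_block K) :
    'M[K]_(jkb_rows b, jkb_cols b) :=
  match b with
  | Jordan (Some mu) n => mu *: diag_one K n n + superdiag_one K n n
  | Jordan None n => diag_one K n n
  | Horizontal h => superdiag_one K h.-1 h
  | Vertical v => subdiag_one K v v.-1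
  end.

Definition jkb_B (K : fieldType) (b : jk_block K) :
    'M[K]_(jkb_rows b, jkb_cols b) :=
  match b with
  | Jordan (Some _) n => - diag_one K n n
  | Jordan None n => - superdiag_one K n n
  | Horizontal h => - diag_one K h.-1 h
  | Vertical v => - diag_one K v v.-1
  end.

Fixpoint jk_rows (K : Type) (s : seq (jk_block K)) : nat :=
  if s is b :: s' then (jkb_rows b + jk_rows s')%N else 0%N.

Fixpoint jk_cols (K : Type) (s : seq (jk_block K)) : nat :=
  if s is b :: s' then (jkb_cols b + jk_cols s')%N else 0%N.

Fixpoint jk_mx (K : fieldType) (lambda : K) (s : seq (jk_block K)) :
    'M[K]_(jk_rows s, jk_cols s) :=
  match s with
  | [::] => 0
  | b :: s' => block_mx (jkb_A b + lambda *: jkb_B b) 0 0 (jk_mx lambda s')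
  end.

(* Matrices act on columns: column j of the matrix of a map U -> W holds the
   coordinates in the basis f of the image of the j-th vector of the basis e. *)
Definition jk_form (K : fieldType) (U W : vectType K) (A B : 'Hom(U, W))
    (s : seq (jk_block K)) : Prop :=
  all (@jkb_pos K) s /\
  exists (e : (jk_cols s).-tuple U) (f : (jk_rows s).-tuple W),
    [/\ basis_of {: U} e, basis_of {: W} f &
      forall (lambda : K) (j : 'I_(jk_cols s)),
        (A + lambda *: B) (tnth e j) =
          \sum_(i < jk_rows s) jk_mx lambda s i j *: tnth f i].

Definition jk_vertical (K : Type) (s : seq (jk_block K)) : seq nat :=
  pmap (fun b => if b is Vertical v then Some v else None) s.

Definition jk_horizontal (K : Type) (s : seq (jk_block K)) : seq nat :=
  pmap (fun b => if b is Horizontal h then Some h else None) s.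

Definition jk_jordan (K : fieldType) (mu : option K) (s : seq (jk_block K)) :
    seq nat :=
  pmap (fun b => if b is Jordan nu n then
                   if nu == mu then Some n else None
                 else None) s.

(* Same horizontal and vertical indices, and same number and sizes of Jordan
   blocks for corresponding eigenvalues, under some bijection of K + {infinity}:
   the eigenvalues themselves may differ. *)
Definition same_jk_type (K : fieldType) (s t : seq (jk_block K)) : Prop :=
  [/\ perm_eq (jk_horizontal s) (jk_horizontal t),
      perm_eq (jk_vertical s) (jk_vertical t) &
      exists2 sigma : option K -> option K, bijective sigma &
        forall mu, perm_eq (jk_jordan mu s) (jk_jordan (sigma mu) t)].

Definition vertical_indices (K : fieldType) (U W : vectType K)
    (A B : 'Hom(U, W)) (v : seq nat) : Prop :=
  exists2 s, jk_form A B s & v = sort leq (jk_vertical s).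

Definition generic_pair (K : fieldType) (g V : vectType K)
    (rho : 'Hom(g, 'End(V))) (a b : V) : Prop :=
  exists D : (V * V)%type -> Prop,
    [/\ zariski_open D, D (a, b) &
      forall x y x' y' : V, D (x, y) -> D (x', y') ->
        exists s t : seq (jk_block K),
          [/\ jk_form (orbit_map rho x) (orbit_map rho y) s,
              jk_form (orbit_map rho x') (orbit_map rho y') t &
              same_jk_type s t]].

(* Vertical indices of a representation, in nondecreasing order.  The first
   conjunct keeps the second from being vacuous. *)
Definition rep_vertical_indices (K : fieldType) (g V : vectType K)
    (rho : 'Hom(g, 'End(V))) (v : seq nat) : Prop :=
  (exists a b : V, generic_pair rho a b) /\
  (forall a b : V, generic_pair rho a b ->
     vertical_indices (orbit_map rho a) (orbit_map rho b) v).

(* Main.v *)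
Require Import Defs.
From Stdlib Require Import Classical.
From mathcomp Require Import all_boot all_order all_algebra.
From mathcomp Require Import complex reals mpoly.

(** For an invariant [f] and a pair [(a, b)], the differential of [f] at
    [a + t b] annihilates the image of [R_a + t R_b].  It is thus a polynomial
    in [t], of degree less than [deg f], with values in the left kernel of the
    pencil ([gradient_left_kernel]).  In the Jordan-Kronecker form only vertical
    blocks have a nonzero left kernel, and the one of a vertical block of height
    [v] consists of the multiples of [(1, t, ..., t^(v-1))].  A solution of
    degree less than [d] therefore involves only the vertical blocks of height at
    most [d], and its value at [t = 0] lies in a space whose dimension is the
    number of these blocks ([jk_left_kernel]).

    In characteristic zero, algebraically independent polynomials have linearly
    independent gradients at all points outside a proper closed subset
    ([alg_independent_jacobian]).  Choose a generic pair [(a, b)] with [a]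
    outside this subset.  For each [k], the gradients at [a] of the [k] invariants of
    lowest degree are [k] independent vectors in the space found above for
    [d = deg f_k].  So at least [k] vertical indices are at most [deg f_k], which
    is the assertion.

    The Jacobian criterion rests on two facts.  More than [n] polynomials in [n]
    variables are algebraically dependent ([alg_independent_leq], by counting
    monomials).  And when an independent family is maximal among those obtained
    by adjoining variables, every variable satisfies a separable relation over it;
    differentiating these relations shows that the gradients of the family span
    the whole space ([jacobian_maximal]). *)

Set Implicit Arguments.
Unset Strict Implicit.
Unset Printing Implicit Defensive.

Import GRing.Theory.
Local Open Scope ring_scope.

(** * Derivations and polynomial substitution *)

Lemma mderivXU (K : nzRingType) (n : nat) (i j : 'I_n) :
  ('X_i)^`M(j) = (i == j)%:R :> {mpoly K[n]}.
Proof.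
rewrite mderivX mnm1E; case: eqP => [->|_]; last by rewrite scale0r.
have -> : (U_(j) - U_(j))%MM = 0%MM :> 'X_{1.. n}.
  by apply/mnmP => k; rewrite mnmBE subnn mnm0E.
by rewrite scale1r mpolyX0.
Qed.

(** Chain rule.  The polynomials satisfying it are closed under sums and
    products by the Leibniz rule, and it holds for constants and variables.
    Stated for an arbitrary derivation [D] of the target ring, so that it
    covers both partial derivatives of a composition and the derivative of the
    restriction to a line. *)
Lemma derivation_mmap (K A : comNzRingType) (n : nat) (c : {rmorphism K -> A})
    (h : 'I_n -> A) (D : {additive A -> A}) :
  (forall x y, D (x * y) = D x * y + x * D y) -> (forall a, D (c a) = 0) ->
  forall p : {mpoly K[n]},
    D (mmap c h p) = \sum_(k < n) mmap c h p^`M(k) * D (h k).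
Proof.
move=> DM Dc.
pose E (p : {mpoly K[n]}) :=
  D (mmap c h p) = \sum_(k < n) mmap c h p^`M(k) * D (h k).
have EC a : E a%:MP.
  rewrite /E mmapC Dc big1 // => k _.
  by rewrite mderivC mmap0 mul0r.
have EX i : E 'X_i.
  rewrite /E mmapX mmap1U (bigD1 i) //= big1 => [|k ki].
    by rewrite mderivXU eqxx mulr1n (rmorph1 (mmap c h)) mul1r addr0.
  by rewrite mderivXU eq_sym (negbTE ki) mulr0n mmap0 mul0r.
have EM p q : E p -> E q -> E (p * q).
  rewrite /E => Ep Eq; rewrite rmorphM DM Ep Eq mulr_suml mulr_sumr.
  rewrite -big_split; apply: eq_bigr => k _ /=.
  by rewrite mderivM rmorphD !rmorphM mulrDl mulrA -!mulrA [D _ * _]mulrC.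
have ED p q : E p -> E q -> E (p + q).
  rewrite /E => Ep Eq; rewrite mmapD raddfD Ep Eq -big_split.
  by apply: eq_bigr => k _ /=; rewrite mderivD mmapD mulrDl.
have EXm m : E 'X_[m].
  rewrite mpolyXE_id; apply: big_ind => //; first by rewrite -mpolyC1.
  move=> i _; elim: (m i) => [|d IHd]; first by rewrite expr0 -mpolyC1.
  by rewrite exprS; apply: EM.
elim/mpolyind => [|a m p _ _ Ep]; first by have := EC 0; rewrite mpolyC0.
by apply: ED => //; rewrite -mul_mpolyC; apply: EM.
Qed.

Lemma mderiv_comp (K : comNzRingType) (n N : nat) (p : {mpoly K[N]})
    (y : N.-tuple {mpoly K[n]}) (i : 'I_n) :
  (p \mPo y)^`M(i) = \sum_(k < N) (p^`M(k) \mPo y) * (tnth y k)^`M(i).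
Proof.
apply: (@derivation_mmap _ _ _ (@mpolyC n K) (tnth y) (@mderiv n K i)).
  exact: mderivM.
exact: mderivC.
Qed.

Lemma msize_mderiv (K : nzRingType) (n : nat) (p : {mpoly K[n]}) (i : 'I_n) :
  (msize p^`M(i) <= (msize p).-1)%N.
Proof.
rewrite msizeE; apply/bigmax_leqP_seq => m; rewrite mcoeff_msupp mcoeff_deriv.
move=> nz _; have: (m + U_(i))%MM \in msupp p.
  by rewrite mcoeff_msupp; apply: contraNneq nz => ->; rewrite mul0rn.
by move/msize_mdeg_lt; rewrite mdegD mdeg1 addn1; case: (msize p).
Qed.

(** * Restriction of polynomials to lines *)

Definition line_restr (K : comNzRingType) (n : nat) (u w : 'I_n -> K)
    (p : {mpoly K[n]}) : {poly K} :=
  mmap (@polyC K) (fun i => (u i)%:P + w i *: 'X) p.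

Lemma horner_line_restr (K : comNzRingType) (n : nat) (u w : 'I_n -> K)
    (p : {mpoly K[n]}) (t : K) :
  (line_restr u w p).[t] = p.@[fun i => u i + t * w i].
Proof.
rewrite /line_restr /meval /mmap horner_sum; apply: eq_bigr => m _.
rewrite hornerM hornerC; congr (_ * _); rewrite /mmap1 horner_prod.
by apply: eq_bigr => i _; rewrite !hornerE mulrC.
Qed.

Lemma size_line_restr (K : idomainType) (n : nat) (u w : 'I_n -> K)
    (p : {mpoly K[n]}) :
  (size (line_restr u w p) <= msize p)%N.
Proof.
apply: (leq_trans (size_sum _ _ _)); apply/bigmax_leqP_seq => m mp _.
apply: leq_trans (msize_mdeg_lt mp).
rewrite mul_polyC; apply: (leq_trans (size_scale_leq _ _)).
rewrite mdegE /mmap1.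
elim/big_ind2: _ => [|q d q' d' Hq Hq'|i _]; first by rewrite size_poly1.
  apply: (leq_trans (size_polyMleq _ _)).
  by rewrite -subn1 leq_subLR (leq_trans (leq_add Hq Hq')) // addSn addnS.
apply: (leq_trans (size_poly_exp_leq _ _)).
rewrite ltnS -[leqRHS]mul1n leq_mul2r; apply/orP; right.
rewrite -subn1 leq_subLR (leq_trans (size_polyD _ _)) // geq_max.
rewrite (leq_trans (size_polyC_leq1 _)) //=.
by rewrite (leq_trans (size_scale_leq _ _)) ?size_polyX.
Qed.

Lemma deriv_line_restr (K : comNzRingType) (n : nat) (u w : 'I_n -> K)
    (p : {mpoly K[n]}) :
  (line_restr u w p)^`() = \sum_(k < n) line_restr u w p^`M(k) * (w k)%:P.
Proof.
rewrite /line_restr.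
rewrite (@derivation_mmap _ _ _ (@polyC K) _ (@deriv K)); last first.
- exact: derivC.
- exact: derivM.
apply: eq_bigr => k _ /=.
by rewrite derivD derivC derivZ derivX add0r alg_polyC.
Qed.

(** The integers form an infinite supply of roots. *)
Lemma poly_eq0_of_horner (K : idomainType) (p : {poly K}) :
  [pchar K] =i pred0 -> (forall t : K, p.[t] = 0) -> p = 0.
Proof.
move=> /pcharf0P char0 p0.
apply: (@roots_geq_poly_eq0 _ _ [seq k%:R | k <- iota 0 (size p)]).
- by apply/allP => t _; apply/eqP/p0.
- rewrite map_inj_uniq ?iota_uniq // => a b.
  wlog ab : a b / (a <= b)%N => [IH|].
    by case/orP: (leq_total a b) => ? e; [|symmetry]; apply: IH.
  rewrite /= -(subnK ab) natrD => /eqP; rewrite eq_sym -subr_eq0 addrK char0.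
  by move=> /eqP ->.
by rewrite size_map size_iota.
Qed.

Lemma mcoeff_mderiv_eq0 (K : idomainType) (n : nat) (p : {mpoly K[n]}) i
    (m : 'X_{1..n}) :
  [pchar K] =i pred0 -> p^`M(i) = 0 -> m i != 0%N -> p@_m = 0.
Proof.
move=> /pcharf0P char0 dp0 mi; have := mcoeff_deriv i (m - U_(i))%MM p.
rewrite submK; last first.
  by apply/mnm_lepP => j; rewrite mnm1E; case: eqP => // <-; rewrite lt0n.
rewrite dp0 mcoeff0 => /esym /eqP; rewrite -mulr_natr mulf_eq0 char0 orbF.
by move=> /eqP.
Qed.

(** Induction on the degree: if [p] vanishes everywhere, then so does its
    restriction to the line through [u] in the [i]-th coordinate direction, and
    the derivative of that restriction at [0] is the [i]-th partial derivative
    of [p] at [u].  So all partial derivatives are zero, and [p] is a constant. *)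
Lemma mpoly_eq0_of_eval (K : idomainType) (n : nat) (p : {mpoly K[n]}) :
  [pchar K] =i pred0 -> (forall u : 'I_n -> K, p.@[u] = 0) -> p = 0.
Proof.
move=> char0.
elim: {p}(msize p) {-2}p (leqnn (msize p)) => [|d IHd] p.
  by rewrite leqn0 msize_poly_eq0 => /eqP.
move=> sp pv.
have dp i : p^`M(i) = 0.
  apply: IHd => [|u].
    by rewrite (leq_trans (msize_mderiv p i)) // -subn1 leq_subLR.
  pose w (k : 'I_n) : K := (k == i)%:R.
  have /(congr1 (fun q => q^`().[0])) : line_restr u w p = 0.
    by apply: poly_eq0_of_horner => // t; rewrite horner_line_restr pv.
  rewrite deriv_line_restr deriv0 horner0 horner_sum => <-.
  rewrite (bigD1 i) //= big1 => [|k ki]; rewrite hornerM hornerC /w.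
    rewrite eqxx mulr1 addr0 horner_line_restr; apply: meval_eq => k.
    by rewrite mul0r addr0.
  by rewrite (negbTE ki) mulr0.
suff pC : p = (p@_0)%:MP.
  by rewrite pC -(@mevalC n _ (fun=> 0) p@_0) -pC pv mpolyC0.
apply/mpolyP => m; rewrite mcoeffC; have [->|m0] := eqVneq m 0%MM.
  by rewrite mulr1.
rewrite mulr0; have [i mi] : exists i, m i != 0%N.
  apply: NNPP => nex; case/eqP: m0; apply/mnmP => i; rewrite mnm0E.
  by apply/eqP/negPn/negP => mi; apply: nex; exists i.
exact: mcoeff_mderiv_eq0 (dp i) mi.
Qed.

(** * Algebraic independence and the Jacobian criterion *)

Lemma msize_comp_mpolyX (K : idomainType) (n N d : nat)
    (y : N.-tuple {mpoly K[n]}) (m : 'X_{1..N}) :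
  (forall i, msize (tnth y i) <= d.+1)%N ->
  (msize ('X_[m] \mPo y) <= (mdeg m * d).+1)%N.
Proof.
move=> yd; rewrite comp_mpolyX mdegE big_distrl /=.
have mulP p q a b : (msize p <= a.+1 -> msize q <= b.+1 ->
    msize (p * q : {mpoly K[n]}) <= (a + b).+1)%N.
  have [->|p0] := eqVneq p 0; first by rewrite mul0r msize0.
  have [->|q0] := eqVneq q 0; first by rewrite mulr0 msize0.
  move=> pa qb; rewrite msizeM // -subn1 leq_subLR.
  by rewrite (leq_trans (leq_add pa qb)) // addSn addnS.
elim/big_ind2: _ => [|q a q' a' Hq Hq'|i _]; first by rewrite msize1.
  exact: mulP.
elim: (m i) => [|k IHk]; first by rewrite expr0 msize1.
by rewrite exprS mulSn; apply: mulP.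
Qed.

(** Counting monomials.  With [d] a bound on the degrees of the [y_i], the
    [b ^ N] monomials in [y] with all exponents below [b] lie in the span of the
    monomials in [n] variables with all exponents below [B = N b d + 1].  If
    [N > n] and [b] is large, then there are more of the former than of the
    latter, so a nontrivial linear combination of the former is zero. *)
Lemma alg_independent_leq (K : fieldType) (n N : nat)
    (y : N.-tuple {mpoly K[n]}) :
  alg_independent y -> (N <= n)%N.
Proof.
move=> indy; rewrite leqNgt; apply/negP => ltnN.
pose d := \max_(i < N) msize (tnth y i).
(* Chosen so that B ^ n <= (b (N d + 1)) ^ n = b ^ n (b - 1) < b ^ (n + 1). *)
pose b := ((N * d).+1 ^ n).+1.
pose B := (N * b * d).+1.
pose T := {ffun 'I_N -> 'I_b}; pose S := {ffun 'I_n -> 'I_B}.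
have ltST : (#|S| < #|T|)%N.
  rewrite !card_ffun !card_ord.
  apply: leq_ltn_trans (_ : (b * (N * d).+1) ^ n < _)%N.
    have leqB : (B <= b * (N * d).+1)%N.
      by rewrite /B mulnS (mulnC N b) mulnA -addn1 addnC leq_add2r.
    by case: (n) => // n'; rewrite leq_exp2r.
  rewrite expnMn mulnC.
  apply: (@leq_trans (b ^ n.+1)); last by rewrite leq_pexp2l.
  by rewrite expnS ltn_pmul2r ?expn_gt0.
pose mT (e : T) : 'X_{1..N} := [multinom (e i : nat) | i < N].
pose mS (e : S) : 'X_{1..n} := [multinom (e i : nat) | i < n].
have mT_inj : injective mT.
  move=> e e' /mnmP ee'; apply/ffunP => i; apply: val_inj.
  by have := ee' i; rewrite !mnmE.
pose q e := 'X_[mT e] \mPo y.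
have sq e : (msize (q e) <= B)%N.
  apply: leq_trans (msize_comp_mpolyX (d := d) _ _) _ => [i|].
    by rewrite ltnW // ltnS /d; apply: (leq_bigmax i).
  rewrite ltnS leq_mul2r; apply/orP; right; rewrite mdegE.
  rewrite -[X in (_ <= X * _)%N]card_ord -sum_nat_const; apply: leq_sum => i _.
  by rewrite mnmE ltnW.
pose M : 'M[K]_(#|T|, #|S|) :=
  \matrix_(i, j) (q (enum_val i))@_(mS (enum_val j)).
(* The coefficients of a linear relation between the rows of M. *)
pose u := nz_row (kermx M).
have u0 : u != 0.
  rewrite nz_row_eq0 kermx_eq0 /row_free neq_ltn.
  by rewrite (leq_ltn_trans (rank_leq_col _)).
have uM : u *m M = 0 by apply/sub_kermxP/nz_row_sub.
pose p := \sum_i u 0 i *: 'X_[K, mT (enum_val i)].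
have py : p \mPo y = 0.
  apply/mpolyP => m; rewrite mcoeff0.
  have -> : (p \mPo y)@_m = \sum_i u 0 i * (q (enum_val i))@_m.
    rewrite [p \mPo y](raddf_sum (comp_mpoly y)) [LHS]raddf_sum.
    by apply: eq_bigr => i _; rewrite /= comp_mpolyZ mcoeffZ.
  have [mB|] := boolP [forall j, m j < B]%N.
    pose s : S := [ffun j => inord (m j)].
    have ms : m = mS s.
      apply/mnmP => j; rewrite mnmE ffunE inordK //.
      exact: (forallP mB).
    have /rowP/(_ (enum_rank s)) := uM; rewrite !mxE => uMs.
    rewrite -[RHS]uMs; apply: eq_bigr => i _.
    by rewrite mxE enum_rankK -ms.
  rewrite negb_forall => /existsP[j]; rewrite -leqNgt => mj.
  apply: big1 => i _.
  rewrite memN_msupp_eq0 ?mulr0 // msize_mdeg_ge //.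
  apply: leq_trans (sq _) (leq_trans mj _).
  by rewrite mdegE (bigD1 j) //= leq_addr.
case/eqP: u0; apply/rowP => i; rewrite mxE.
have /(congr1 (mcoeff (mT (enum_val i)))) := indy p py.
rewrite mcoeff0 raddf_sum /= (bigD1 i) //= big1 => [|k ki].
  by rewrite mcoeffZ mcoeffX eqxx mulr1 addr0.
rewrite mcoeffZ mcoeffX; case: eqP => [/mT_inj/enum_val_inj e|_].
  by rewrite e eqxx in ki.
by rewrite mulr0.
Qed.

Lemma comp_mpolyA (K : comNzRingType) (n N k : nat) (p : {mpoly K[N]})
    (t : N.-tuple {mpoly K[k]}) (y : k.-tuple {mpoly K[n]}) :
  (p \mPo t) \mPo y = p \mPo [tuple tnth t i \mPo y | i < N].
Proof.
rewrite (comp_mpolyE p t) (raddf_sum (comp_mpoly y)) comp_mpolyE.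
apply: eq_bigr => m _ /=; rewrite comp_mpolyZ rmorph_prod /=.
by congr (_ *: _); apply: eq_bigr => i _; rewrite rmorphXn tnth_mktuple.
Qed.

(** Differentiation multiplies the coefficient of a monomial by its exponent,
    so in characteristic zero [P] does not involve the variable [0]. *)
Lemma comp_mpoly_cons (K : idomainType) (n N : nat) (P : {mpoly K[N.+1]})
    (h h' : {mpoly K[n]}) (y : N.-tuple {mpoly K[n]}) :
  [pchar K] =i pred0 -> P^`M(ord0) = 0 ->
  P \mPo [tuple of h :: y] = P \mPo [tuple of h' :: y].
Proof.
move=> char0 dP; rewrite !comp_mpolyE; apply: eq_bigr => m _.
have [m0|m0] := eqVneq (m ord0) 0%N; last first.
  by rewrite (mcoeff_mderiv_eq0 char0 dP m0) !scale0r.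
congr (_ *: _); rewrite !big_ord_recl m0 !expr0; congr (_ * _).
by apply: eq_bigr => i _; rewrite !tnthS.
Qed.

(** Putting [0] for the variable [0] of [P] gives a relation between the [y_i],
    which is zero; as [P] does not involve that variable, nothing was lost. *)
Lemma comp_mpoly_cons_eq0 (K : fieldType) (n N : nat) (P : {mpoly K[N.+1]})
    (h : {mpoly K[n]}) (y : N.-tuple {mpoly K[n]}) :
  [pchar K] =i pred0 -> P^`M(ord0) = 0 -> alg_independent y ->
  P \mPo [tuple of h :: y] = 0 -> P = 0.
Proof.
move=> char0 dP indy Phy.
pose X : N.-tuple {mpoly K[N]} := [tuple 'X_i | i < N].
pose X' : N.-tuple {mpoly K[N.+1]} := [tuple 'X_(lift ord0 i) | i < N].
have P'0 : P \mPo [tuple of 0 :: X] = 0.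
  apply: indy; rewrite comp_mpolyA -[RHS]Phy -(comp_mpoly_cons 0 h y char0 dP).
  congr (_ \mPo _); apply: eq_from_tnth => i; rewrite tnth_mktuple.
  case: (unliftP ord0 i) => [j|] ->; last by rewrite !tnth0 comp_mpoly0.
  by rewrite !tnthS tnth_mktuple comp_mpolyXU -tnth_nth.
rewrite -[LHS]comp_mpoly_id -[RHS](comp_mpoly0 X') -P'0 comp_mpolyA.
transitivity (P \mPo [tuple of 'X_ord0 :: X']).
  congr (_ \mPo _); apply: eq_from_tnth => i; rewrite tnth_mktuple.
  by case: (unliftP ord0 i) => [j|] ->; rewrite ?tnth0 // tnthS tnth_mktuple.
rewrite (comp_mpoly_cons _ 0 _ char0 dP).
congr (_ \mPo _); apply: eq_from_tnth => i; rewrite tnth_mktuple.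
case: (unliftP ord0 i) => [j|] ->; last by rewrite !tnth0 comp_mpoly0.
by rewrite !tnthS !tnth_mktuple comp_mpolyXU -tnth_nth tnth_mktuple.
Qed.

(** The analogue of separability of a minimal polynomial: from any relation
    [P] between [h] and [y] one descends to its derivative in the variable of
    [h] as long as that derivative is again a relation.  The descent cannot
    reach zero, since then [P] would be a relation between the [y_i] alone. *)
Lemma separable_relation (K : fieldType) (n N : nat)
    (h : {mpoly K[n]}) (y : N.-tuple {mpoly K[n]}) :
  [pchar K] =i pred0 -> alg_independent y ->
  ~ alg_independent [tuple of h :: y] ->
  exists P : {mpoly K[N.+1]}, P \mPo [tuple of h :: y] = 0 /\
    P^`M(ord0) \mPo [tuple of h :: y] != 0.
Proof.
move=> char0 indy dep; set hy := [tuple of _].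
have [P [Phy P0]] : exists P : {mpoly K[N.+1]}, P \mPo hy = 0 /\ P <> 0.
  apply: NNPP => nex; apply: dep => P Phy; apply: NNPP => P0.
  by apply: nex; exists P.
elim: {P}(msize P) {-2}P (leqnn (msize P)) Phy P0 => [|d IHd] P.
  by rewrite leqn0 msize_poly_eq0 => /eqP.
move=> sP Phy P0; have [dPhy|] := eqVneq (P^`M(ord0) \mPo hy) 0; last first.
  by exists P.
apply: (IHd P^`M(ord0)) => // [|dP].
  by rewrite (leq_trans (msize_mderiv P _)) // -subn1 leq_subLR.
by apply: P0; apply: comp_mpoly_cons_eq0 Phy.
Qed.

Definition jacobian (K : comNzRingType) (n N : nat)
    (y : N.-tuple {mpoly K[n]}) (u : 'I_n -> K) : 'M[K]_(N, n) :=
  \matrix_(i, j) ((tnth y i)^`M(j)).@[u].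

Lemma row_free_rowsub (K : fieldType) (m n p : nat) (g : 'I_p -> 'I_m)
    (A : 'M[K]_(m, n)) :
  injective g -> row_free A -> row_free (rowsub g A).
Proof.
move=> g_inj /row_freeP[B AB]; apply/row_freeP; exists (B *m (rowsub g 1%:M)^T).
rewrite mulmxA rowsubE -[_ *m A *m B]mulmxA AB mulmx1.
apply/matrixP => i j; rewrite !mxE (bigD1 (g i)) //= !mxE big1 => [|k ki].
  by rewrite eqxx mul1r addr0 [in RHS]eq_sym (inj_eq g_inj).
by rewrite !mxE eq_sym (negbTE ki) mul0r.
Qed.

(** Differentiating a relation [P_i] between ['X_i] and [y] that is separable in
    ['X_i] expresses [q_i] times the differential of ['X_i] through the
    differentials of the [y_k], with [q_i != 0].  At a point where no [q_i]
    vanishes, the gradients of the [y_k] thus span the whole space; as there are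
    at most [n] of them, they are linearly independent. *)
Lemma jacobian_maximal (K : fieldType) (n N : nat)
    (y : N.-tuple {mpoly K[n]}) :
  [pchar K] =i pred0 -> alg_independent y ->
  (forall i : 'I_n, ~ alg_independent [tuple of 'X_i :: y]) ->
  exists2 Q : {mpoly K[n]}, Q != 0 &
    forall u, Q.@[u] != 0 -> row_free (jacobian y u).
Proof.
move=> char0 indy dep.
have sep i := separable_relation char0 indy (dep i).
have [P /all_and2 [Py dPy]] := fin_all_exists sep.
pose q i := (P i)^`M(ord0) \mPo [tuple of 'X_i :: y].
exists (\prod_i q i) => [|u]; first by apply/prodf_neq0 => i _; apply: dPy.
rewrite rmorph_prod => /prodf_neq0 qu.
pose C := \matrix_(i < n, k < N)
  - ((P i)^`M(lift ord0 k) \mPo [tuple of 'X_i :: y]).@[u].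
have CJ : C *m jacobian y u = diag_mx (\row_i (q i).@[u]).
  apply/matrixP => i j; rewrite !mxE.
  have /(congr1 (fun p => (mderiv j p).@[u])) := Py i.
  rewrite mderiv_comp mderiv0 meval0 raddf_sum /= big_ord_recl.
  rewrite mevalM tnth0 -/(q i) => /eqP; rewrite addr_eq0 => /eqP e.
  transitivity ((q i).@[u] * ('X_i)^`M(j).@[u]).
    rewrite e -sumrN; apply: eq_bigr => k _.
    by rewrite !mxE mevalM tnthS mulNr.
  by rewrite mderivXU; case: eqP; rewrite ?meval1 ?mulr1 // meval0 mulr0.
have full : row_full (jacobian y u).
  rewrite -sub1mx; apply: submx_trans (submxMl C _).
  rewrite CJ; set D := diag_mx _; have uD : D \in unitmx.
    rewrite unitmxE det_diag unitfE; apply/prodf_neq0 => i _.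
    by rewrite mxE qu.
  by rewrite -(mulVmx uD) submxMl.
rewrite /row_free eqn_leq rank_leq_row.
by rewrite (eqP full : \rank _ = n) (alg_independent_leq indy).
Qed.

(** Jacobian criterion.  Adjoining variables to [y] as long as the family stays
    algebraically independent ends after at most [n - N] steps, with a family to
    which [jacobian_maximal] applies; the gradients of [y] are some of those of
    this family. *)
Lemma alg_independent_jacobian (K : fieldType) (n N : nat)
    (y : N.-tuple {mpoly K[n]}) :
  [pchar K] =i pred0 -> alg_independent y ->
  exists2 Q : {mpoly K[n]}, Q != 0 &
    forall u, Q.@[u] != 0 -> row_free (jacobian y u).
Proof.
move=> char0 indy; have [d nN] : exists d, (n - N <= d)%N by exists (n - N)%N.
elim: d N y indy nN => [|d IHd] N y indy nN.
  apply: jacobian_maximal => // i /alg_independent_leq.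
  by rewrite leqNgt ltnS -subn_eq0 -leqn0 nN.
have [[i indXy]|/not_ex_all_not dep] :=
    classic (exists i : 'I_n, alg_independent [tuple of 'X_i :: y]).
  have [|Q Q0 Qfree] := IHd _ _ indXy; first by rewrite subnS -subn1 leq_subLR.
  exists Q => // u /Qfree/(row_free_rowsub (@lift_inj _ ord0)).
  congr (is_true (row_free _)); apply/matrixP => k j.
  by rewrite !mxE tnthS.
exact: jacobian_maximal.
Qed.

(** * The left kernel of a Jordan-Kronecker pencil *)

(** Entries indexed by [nat] and extended by zero, so that the shifted indices
    that the off-diagonal matrices produce need no range proofs. *)
Definition rcoef (R : nzRingType) (n : nat) (w : 'rV[R]_n) (k : nat) : R :=
  if insub k is Some i then w 0 i else 0.

Lemma rcoefE (R : nzRingType) (n : nat) (w : 'rV[R]_n) (i : 'I_n) :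
  w 0 i = rcoef w i.
Proof. by rewrite /rcoef valK. Qed.

Lemma sum_rcoef (R : nzRingType) (n : nat) (w : 'rV[R]_n) (k : nat) :
  \sum_(i < n) w 0 i * (i == k :> nat)%:R = rcoef w k.
Proof.
rewrite /rcoef; case: insubP => [i _ ik|]; last first.
  rewrite -leqNgt => nk; apply: big1 => i _; case: eqP => [ik|].
    by have := ltn_ord i; rewrite ik ltnNge nk.
  by rewrite mulr0.
rewrite (bigD1 i) //= ik eqxx mulr1 big1 ?addr0 // => j ji.
case: eqP => [jk|]; last by rewrite mulr0.
by case/eqP: ji; apply: val_inj; rewrite /= jk.
Qed.

Definition row_at (K : comNzRingType) (n : nat) (t : K) (w : 'rV[{poly K}]_n) :
    'rV[K]_n :=
  map_mx (horner_eval t) w.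

Lemma rcoef_row_at (K : comNzRingType) (n : nat) (t : K)
    (w : 'rV[{poly K}]_n) (k : nat) :
  rcoef (row_at t w) k = (rcoef w k).[t].
Proof.
by rewrite /rcoef; case: insubP => [i _ _|_]; rewrite ?mxE ?horner0.
Qed.

Lemma mul_diag_one (K : fieldType) (p n : nat) (w : 'rV[K]_p) (j : 'I_n) :
  (w *m diag_one K p n) 0 j = rcoef w j.
Proof. by rewrite mxE -sum_rcoef; apply: eq_bigr => i _; rewrite mxE. Qed.

Lemma mul_subdiag_one (K : fieldType) (p n : nat) (w : 'rV[K]_p) (j : 'I_n) :
  (w *m subdiag_one K p n) 0 j = rcoef w j.+1.
Proof. by rewrite mxE -sum_rcoef; apply: eq_bigr => i _; rewrite mxE. Qed.

Lemma mul_superdiag_one (K : fieldType) (p n : nat) (w : 'rV[K]_p) (j : 'I_n) :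
  (w *m superdiag_one K p n) 0 j = if (j : nat) is k.+1 then rcoef w k else 0.
Proof.
rewrite mxE; case: j => [[|k] jn] /=.
  by apply: big1 => i _; rewrite mxE mulr0.
by rewrite -sum_rcoef; apply: eq_bigr => i _; rewrite mxE eqSS.
Qed.

(** The columns of a Jordan or horizontal block determine each entry of a row
    in the left kernel from the previous one, starting from zero. *)
Lemma chain_eq0 (R : idomainType) (n : nat) (c : nat -> R) (a e : R) :
  a != 0 ->
  (forall j, (j < n)%N -> a * c j = if j is k.+1 then e * c k else 0) ->
  forall j, (j < n)%N -> c j = 0.
Proof.
move=> a0 ac; elim=> [|j IHj] jn; apply: (mulfI a0); rewrite mulr0 ac //.
by rewrite IHj ?mulr0 // ltnW.
Qed.

Lemma mul_pencil (K : fieldType) (p n : nat) (w : 'rV[K]_p)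
    (A B : 'M[K]_(p, n)) (t : K) (j : 'I_n) :
  (w *m (A + t *: B)) 0 j = (w *m A) 0 j + t * (w *m B) 0 j.
Proof. by rewrite mulmxDr -scalemxAr [LHS]mxE [X in _ + X]mxE. Qed.

Lemma mul_opp_diag_one (K : fieldType) (p n : nat) (w : 'rV[K]_p) (j : 'I_n) :
  (w *m - diag_one K p n) 0 j = - rcoef w j.
Proof. by rewrite mulmxN mxE mul_diag_one. Qed.

(** A Jordan or horizontal block has no nonzero polynomial row in its left
    kernel.  For a vertical block of height [v] such a row is [c (1, X, ..., X^(v-1))], which
    has an entry of degree at least [v - 1] unless [c = 0].  So rows with
    entries of degree less than [d] exist only if [v <= d], and their values at
    [0] are multiples of [(1, 0, ..., 0)]. *)
Lemma jk_block_left_kernel (K : fieldType) (b : jk_block K) (d : nat) :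
  [pchar K] =i pred0 ->
  exists2 M : 'M[K]_(jkb_rows b),
    (\rank M <= count (fun v => v <= d) (jk_vertical [:: b]))%N &
    forall w : 'rV[{poly K}]_(jkb_rows b),
      (forall i, size (w 0%R i) <= d)%N ->
      (forall t : K, row_at t w *m (jkb_A b + t *: jkb_B b) = 0) ->
      (row_at 0 w <= M)%MS.
Proof.
move=> char0.
have row0 n (w : 'rV[{poly K}]_n) :
    (forall j, (j < n)%N -> rcoef w j = 0) -> row_at 0 w = 0.
  by move=> w0; apply/rowP => i; rewrite !mxE rcoefE w0 ?horner_evalE ?horner0.
have poly_eq (p q : {poly K}) : (forall t, p.[t] = q.[t]) -> p = q.
  move=> pq; apply/eqP; rewrite -subr_eq0; apply/eqP.
  by apply: poly_eq0_of_horner => // t; rewrite hornerD hornerN pq subrr.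
case: b => [[mu|] n|h|v]; rewrite /jkb_A /jkb_B.
- exists 0 => [|w _ wJ]; first by rewrite mxrank0.
  rewrite row0 ?sub0mx //.
  apply: (@chain_eq0 _ _ _ ('X - mu%:P) 1); first by rewrite polyXsubC_eq0.
  move=> j jn; apply: poly_eq => t.
  have /rowP/(_ (Ordinal jn)) := wJ t.
  rewrite mul_pencil [_ *: _ + _]addrC mul_pencil mul_diag_one.
  rewrite mul_opp_diag_one mul_superdiag_one mxE /= !rcoef_row_at.
  rewrite -addrA => /eqP; rewrite addr_eq0 mulrN opprB -mulrBl => /eqP e.
  rewrite hornerM hornerXsubC -e.
  by case: (j) => [|k]; rewrite ?rcoef_row_at !hornerE.
- exists 0 => [|w _ wJ]; first by rewrite mxrank0.
  rewrite row0 ?sub0mx //.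
  apply: (@chain_eq0 _ _ _ 1 'X); first exact: oner_neq0.
  move=> j jn; apply: poly_eq => t.
  have /rowP/(_ (Ordinal jn)) := wJ t.
  rewrite mul_pencil mul_diag_one mulmxN [X in t * X]mxE mul_superdiag_one.
  rewrite mxE /= rcoef_row_at mul1r => /eqP; rewrite mulrN subr_eq0 => /eqP ->.
  by case: (j) => [|k]; rewrite ?rcoef_row_at !hornerE ?mulr0.
- exists 0 => [|w _ wJ]; first by rewrite mxrank0.
  rewrite row0 ?sub0mx //.
  apply: (@chain_eq0 _ _ _ 'X 1); first by rewrite polyX_eq0.
  move=> j jn; apply: poly_eq => t.
  have jh : (j < h)%N by apply: leq_trans jn (leq_pred h).
  have /rowP/(_ (Ordinal jh)) := wJ t.
  rewrite mul_pencil mul_opp_diag_one mul_superdiag_one mxE /= rcoef_row_at.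
  rewrite hornerM hornerX => /eqP; rewrite mulrN subr_eq0 => /eqP <-.
  by case: (j) => [|k]; rewrite ?rcoef_row_at !hornerE.
have wX (w : 'rV[{poly K}]_v) :
    (forall t, row_at t w *m (subdiag_one K v v.-1 + t *: - diag_one K v v.-1)
       = 0) ->
    forall j, (j < v)%N -> rcoef w j = 'X^j * rcoef w 0.
  move=> wV; elim=> [|j IHj] jv; first by rewrite expr0 mul1r.
  rewrite exprS -mulrA -(IHj (ltnW jv)); apply: poly_eq => t.
  have jv' : (j < v.-1)%N by rewrite -ltnS (ltn_predK jv).
  have /rowP/(_ (Ordinal jv')) := wV t.
  rewrite mul_pencil mul_opp_diag_one mul_subdiag_one mxE /= !rcoef_row_at.
  by rewrite hornerM hornerX => /eqP; rewrite mulrN subr_eq0 => /eqP.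
have [vd|dv] := leqP v d; last first.
  exists 0 => [|w wd /wX {}wX]; first by rewrite mxrank0.
  rewrite row0 ?sub0mx // => j; rewrite [jkb_rows _]/= => jv; rewrite wX //.
  have [->|w0] := eqVneq (rcoef w 0) 0; first by rewrite mulr0.
  have lv : (v.-1 < v)%N by rewrite (ltn_predK jv).
  have := wd (Ordinal lv).
  rewrite rcoefE /= wX // mulrC size_mulXn // leqNgt => /negP[].
  apply: leq_trans dv (leq_trans (leqSpred v) _).
  by rewrite -addn1 leq_add2l size_poly_gt0.
exists <<\row_j (j == 0 :> nat)%:R>>%MS => [|w _ /wX {}wX].
  by rewrite /= vd genmxE rank_leq_row.
rewrite genmxE; apply: submx_trans (scalemx_sub (rcoef w 0).[0] (submx_refl _)).
suff -> : row_at 0 w = (rcoef w 0).[0] *: \row_j (j == 0 :> nat)%:R by [].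
apply/rowP => j; rewrite !mxE horner_evalE rcoefE wX //.
by rewrite hornerM hornerXn expr0n mulrC.
Qed.

(** Values at [0] of the polynomial rows of degree less than [d] in the left
    kernel of the whole pencil: each vertical block of height at most [d]
    contributes at most one dimension. *)
Lemma jk_left_kernel (K : fieldType) (s : seq (jk_block K)) (d : nat) :
  [pchar K] =i pred0 ->
  exists2 M : 'M[K]_(jk_rows s),
    (\rank M <= count (fun v => v <= d) (jk_vertical s))%N &
    forall w : 'rV[{poly K}]_(jk_rows s),
      (forall i, size (w 0%R i) <= d)%N ->
      (forall t : K, row_at t w *m jk_mx t s = 0) ->
      (row_at 0 w <= M)%MS.
Proof.
move=> char0; elim: s => [|b s [Ms rMs wMs]] /=.
  by exists 0 => [|w _ _]; rewrite ?mxrank0 // [row_at 0 w]thinmx0 sub0mx.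
have [Mb rMb wMb] := jk_block_left_kernel b d char0.
exists (block_mx Mb 0 0 Ms) => [|w wd wJ].
  rewrite rank_diag_block_mx; apply: leq_trans (leq_add rMb rMs) _.
  by rewrite -count_cat /jk_vertical -pmap_cat.
have rowE t : row_at t w = row_mx (row_at t (lsubmx w)) (row_at t (rsubmx w)).
  by rewrite -{1}[w]hsubmxK /row_at map_row_mx.
have wJ2 t : row_at t (lsubmx w) *m (jkb_A b + t *: jkb_B b) = 0 /\
    row_at t (rsubmx w) *m jk_mx t s = 0.
  have := wJ t; rewrite rowE mul_row_block !mulmx0 addr0 add0r -row_mx0.
  exact: eq_row_mx.
have /submxP[Lb wb] : (row_at 0 (lsubmx w) <= Mb)%MS.
  by apply: wMb => [i|t]; [rewrite mxE | case: (wJ2 t)].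
have /submxP[Ls ws] : (row_at 0 (rsubmx w) <= Ms)%MS.
  by apply: wMs => [i|t]; [rewrite mxE | case: (wJ2 t)].
apply/submxP; exists (row_mx Lb Ls).
by rewrite rowE wb ws mul_row_block !mulmx0 addr0 add0r.
Qed.

(** * Gradients of invariants along a line *)

Lemma coordsD (K : fieldType) (V : vectType K) (x y : V) i :
  coords (x + y) i = coords x i + coords y i.
Proof. by rewrite /coords linearD. Qed.

Lemma coordsZ (K : fieldType) (V : vectType K) a (x : V) i :
  coords (a *: x) i = a * coords x i.
Proof. by rewrite /coords linearZ. Qed.

Lemma pf_eval_line (K : fieldType) (V : vectType K)
    (p : {mpoly K[\dim {: V}]}) (x y : V) (t : K) :
  pf_eval p (x + t *: y) = (line_restr (coords x) (coords y) p).[t].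
Proof.
rewrite horner_line_restr; apply: meval_eq => i.
by rewrite coordsD coordsZ.
Qed.

Lemma coords_surj (K : fieldType) (V : vectType K)
    (u : 'I_(\dim {: V}) -> K) :
  exists x : V, forall i, coords x i = u i.
Proof.
exists (\sum_i u i *: (vbasis {: V})`_i) => i.
by rewrite /coords coord_sum_free // (basis_free (vbasisP _)).
Qed.

Lemma pf_diff_sum (K : fieldType) (V : vectType K)
    (f : {mpoly K[\dim {: V}]}) (x : V) (n : nat) (c : 'I_n -> K)
    (z : 'I_n -> V) :
  pf_diff f x (\sum_r c r *: z r) = \sum_r c r * pf_diff f x (z r).
Proof.
rewrite /pf_diff; under [RHS]eq_bigr do rewrite mulr_sumr.
rewrite [RHS]exchange_big; apply: eq_bigr => k _ /=.
rewrite /coords linear_sum mulr_sumr; apply: eq_bigr => r _.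
by rewrite linearZ /= mulrCA.
Qed.

Definition coords_mx (K : fieldType) (V : vectType K) (N : nat)
    (z : N.-tuple V) : 'M[K]_(\dim {: V}, N) :=
  \matrix_(k, r) coords (tnth z r) k.

Lemma coords_mx_free (K : fieldType) (V : vectType K) (N : nat)
    (z : N.-tuple V) :
  basis_of {: V} z -> row_free (coords_mx z).
Proof.
move=> zb; apply/row_freeP.
exists (\matrix_(r, k) coord z r (vbasis {: V})`_k).
apply/matrixP => k l; rewrite !mxE.
transitivity (coords ((vbasis {: V})`_l) k); last first.
  by rewrite /coords coord_free ?(basis_free (vbasisP _)) // eq_sym.
rewrite [X in _ = coords X _](coord_basis zb (memvf (vbasis {: V})`_l)).
rewrite /coords linear_sum; apply: eq_bigr => r _.
by rewrite linearZ /= !mxE mulrC (tnth_nth 0).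
Qed.

(** The differential of an invariant [f] at [a + t b] annihilates the image of
    [R_a + t R_b], and it is polynomial in [t] of degree less than [deg f]; [w]
    is this differential, written in the basis [z] of the target. *)
Lemma gradient_left_kernel (K : fieldType) (g V : vectType K)
    (rho : 'Hom(g, 'End(V))) (f : {mpoly K[\dim {: V}]}) (a b : V)
    (s : seq (jk_block K)) (e : (jk_cols s).-tuple g)
    (z : (jk_rows s).-tuple V) :
  invariant_poly rho f ->
  (forall (t : K) (j : 'I_(jk_cols s)),
     (orbit_map rho a + t *: orbit_map rho b) (tnth e j) =
       \sum_(i < jk_rows s) jk_mx t s i j *: tnth z i) ->
  exists w : 'rV[{poly K}]_(jk_rows s),
    [/\ forall i, (size (w 0%R i) <= pf_deg f)%N,
        forall t, row_at t w *m jk_mx t s = 0 &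
        row_at 0 w = (\row_k pf_eval f^`M(k) a) *m coords_mx z].
Proof.
move=> finv pencil.
pose w : 'rV[{poly K}]_(jk_rows s) := \row_r \sum_k
  coords (tnth z r) k *: line_restr (coords a) (coords b) f^`M(k).
have wE t r : row_at t w 0 r = pf_diff f (a + t *: b) (tnth z r).
  rewrite !mxE horner_evalE horner_sum; apply: eq_bigr => k _.
  by rewrite hornerZ mulrC pf_eval_line.
exists w; split=> [r|t|].
- rewrite mxE (leq_trans (size_sum _ _ _)) //; apply/bigmax_leqP => k _.
  rewrite (leq_trans (size_scale_leq _ _)) //.
  by rewrite (leq_trans (size_line_restr _ _ _)) // msize_mderiv.
- apply/rowP => j; rewrite mxE [RHS]mxE -[RHS](finv (a + t *: b) (tnth e j)).
  have -> : rho (tnth e j) (a + t *: b) =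
      \sum_(i < jk_rows s) jk_mx t s i j *: tnth z i.
    by rewrite -pencil add_lfunE scale_lfunE !orbit_mapE linearD linearZ.
  by rewrite pf_diff_sum; apply: eq_bigr => r _; rewrite wE mulrC.
apply/rowP => r; rewrite wE scale0r addr0 mxE /pf_diff; apply: eq_bigr => k _.
by rewrite !mxE.
Qed.

(** A nonempty open set of pairs meets the open set where [Q] is nonzero at the
    first component: on the parametrized line from a point [x] of the former to
    a pair [(y, x.2)] with [Q(y) != 0], each of the two conditions fails for
    finitely many parameters only. *)
Lemma zariski_open_generic (K : fieldType) (V : vectType K)
    (D : (V * V)%type -> Prop) (x : V * V) (Q : {mpoly K[\dim {: V}]}) :
  [pchar K] =i pred0 -> zariski_open D -> D x -> Q != 0 ->
  exists a b : V, D (a, b) /\ pf_eval Q a != 0.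
Proof.
move=> char0 [S DS] /DS[p Sp px] Q0.
have [u Qu] : exists u, Q.@[u] != 0.
  apply: NNPP => nex; case/eqP: Q0; apply: mpoly_eq0_of_eval => // u.
  by apply/eqP/negPn/negP => Qu; apply: nex; exists u.
have [y yu] := coords_surj u.
pose d : V * V := (y - x.1, 0).
pose P1 := line_restr (coords x) (coords d) p.
pose Q1 := line_restr (coords x.1) (coords (y - x.1)) Q.
have PQ0 : P1 * Q1 != 0.
  rewrite mulf_neq0 //.
    apply: contraNneq px => P10; have := pf_eval_line p x d 0.
    by rewrite -/P1 P10 horner0 scale0r addr0 => ->.
  apply: contraNneq Qu => Q10; have := pf_eval_line Q x.1 (y - x.1) 1.
  rewrite -/Q1 Q10 horner0 scale1r subrKC => <-.
  by apply/eqP; apply: meval_eq.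
have [t] : exists t, (P1 * Q1).[t] != 0.
  apply: NNPP => nex; case/eqP: PQ0; apply: poly_eq0_of_horner => // t.
  by apply/eqP/negPn/negP => Pt; apply: nex; exists t.
rewrite hornerM mulf_eq0 negb_or -!pf_eval_line => /andP[Pt Qt].
exists (x.1 + t *: (y - x.1)), x.2; split=> //; apply/DS; exists p => //.
suff -> : (x.1 + t *: (y - x.1), x.2) = x + t *: d by [].
rewrite /d; case: (x) => x1 x2; congr (_, _).
by rewrite /= scaler0 addr0.
Qed.

Lemma nth_sorted_count (v : seq nat) (d k : nat) :
  sorted leq v -> (k < count (fun n => n <= d) v)%N -> (nth 0 v k <= d)%N.
Proof.
move=> sv; apply: contraLR; rewrite -ltnNge -leqNgt => dk.
rewrite -[v](cat_take_drop k) count_cat -[leqRHS]addn0 leq_add //.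
  by rewrite (leq_trans (count_size _ _)) // size_take_min geq_minl.
rewrite leqNgt -has_count; apply/hasPn => n /(nthP 0%N)[j].
rewrite size_drop nth_drop ltn_subRL => jv <-; rewrite -ltnNge.
apply: (leq_trans dk); apply: (sorted_leq_nth leq_trans leqnn) => //.
- by rewrite inE (leq_ltn_trans (leq_addr j k)).
- by rewrite leq_addr.
Qed.

(** * Degrees of invariants *)

(** At a generic pair [(a, b)] the gradients of the [f_i] at [a] are linearly
    independent.  The first [k + 1] of them lie in the space found in
    [jk_left_kernel] for [d = deg f_k], whose dimension is at most the number
    of vertical indices not exceeding [deg f_k]. *)
Lemma invariant_degrees (K : fieldType) (g V : vectType K)
    (rho : 'Hom(g, 'End(V))) (m : nat)
    (f : m.-tuple {mpoly K[\dim {: V}]}) (v : seq nat) :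
  [pchar K] =i pred0 ->
  (forall i : 'I_m, invariant_poly rho (tnth f i)) ->
  alg_independent f ->
  (forall i j : 'I_m, (i <= j)%N ->
    (pf_deg (tnth f i) <= pf_deg (tnth f j))%N) ->
  rep_vertical_indices rho v ->
  (m <= size v)%N /\
  forall i : 'I_m, (nth 0%N v i <= pf_deg (tnth f i))%N.
Proof.
move=> char0 finv indf fdeg [[a0 [b0 [D [Dopen Dab0 Dgen]]]] vgen].
have [Q Q0 Qfree] := alg_independent_jacobian char0 indf.
have [a [b [Dab Qa]]] := zariski_open_generic char0 Dopen Dab0 Q0.
have [|s [_ [e [z [_ zb pencil]]]] vE] := vgen a b; first by exists D.
have vcount (k : 'I_m) : (k < count (fun n => n <= pf_deg (tnth f k)) v)%N.
  rewrite vE (permP (permEl (perm_sort leq _))).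
  have [M rM MP] := jk_left_kernel s (pf_deg (tnth f k)) char0.
  apply: leq_trans rM; have km := ltn_ord k.
  pose J := rowsub (widen_ord km) (jacobian f (coords a)) *m coords_mx z.
  have <- : \rank J = k.+1.
    rewrite mxrankMfree ?coords_mx_free //; apply/eqP.
    apply: row_free_rowsub; last exact: Qfree.
    by move=> i j /(congr1 val) /= ij; apply: val_inj.
  apply: mxrankS; apply/row_subP => i.
  have [w [wdeg wker wJ]] :=
    gradient_left_kernel (finv (widen_ord km i)) pencil.
  have <- : row_at 0 w = row i J.
    by rewrite wJ row_mul; congr (_ *m _); apply/rowP => r; rewrite !mxE.
  apply: MP => // r; apply: leq_trans (wdeg r) _.
  by apply: fdeg; rewrite /= -ltnS.
split=> [|k]; last first.
  apply: nth_sorted_count (vcount k).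
  by rewrite vE; apply/sort_sorted/leq_total.
case: m f {finv indf fdeg Qfree} vcount => // m f /(_ ord_max) vcount.
exact: leq_trans vcount (count_size _ _).
Qed.

Theorem theorem5p1 (R : realType) (g V : vectType R[i])
  (br : g -> g -> g) (hbr : is_lie_bracket br)
  (rho : 'Hom(g, 'End(V))) (hrho : is_lie_rep br rho)
  (m : nat) (f : m.-tuple {mpoly R[i][\dim {: V}]})
  (hinv : forall i : 'I_m, invariant_poly rho (tnth f i))
  (hind : alg_independent f)
  (hdeg : forall i j : 'I_m, (i <= j)%N ->
    (pf_deg (tnth f i) <= pf_deg (tnth f j))%N)
  (v : seq nat) (hv : rep_vertical_indices rho v) :
  (m <= size v)%N /\
  forall i : 'I_m, (nth 0%N v i <= pf_deg (tnth f i))%N.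
Proof.
exact: (invariant_degrees (Num.Theory.pchar_num _) hinv hind hdeg hv).
Qed.
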